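(* Fix an integer $n \geq 1$, a subgroup $G \leq S_2 \wr S_n$ (acting on $u_1,\dots,u_n$ and on $v_1,\dots,v_n$ by signed permutations), and a complex class function $\psi = \sum_{\chi \in \widehat{G}_{\mathbb{C}}} a_\chi \chi$ of $G$, with $a_\chi\in\mathbb{C}$. Let $R$ be a commutative $R_\psi$-algebra. Let $u_i, v_j$ be fermionic variables, let $t$ be an indeterminate, and let $f(t)=\sum_{M\ge 0} f_M t^M \in R[[t]]$ be an arbitrary formal power series. Then \[ |G|\, E_\psi^{\mathbf{u}} \cdot \prod_{j=1}^n f(t u_j v_j) = |G|\, E_{\overline{\psi}}^{\mathbf{v}} \cdot \prod_{j=1}^n f(t u_j v_j) = \sum_{\chi \in \widehat{G}_{\mathbb{C}}} a_\chi \sum_{J \subseteq [n]} (-1)^{\binom{|J|}{2}} f_0^{n-|J|} (f_1 t)^{|J|}\, E_\chi^{\mathbf{u}}(\mathbf{u}^J) \cdot E_{\overline{\chi}}^{\mathbf{v}}(\mathbf{v}^J). \]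
   Context: $\widehat{G}_{\mathbb{C}}$ is the set of irreducible complex characters of the finite group $G$, and $[n] = \{1,\dots,n\}$. $R_\psi \subset \mathbb{C}$ is the unital subring generated over $\mathbb{Z}$ by all coefficients $a_\chi$ and all values $\chi(g)$ with $g \in G$ and $\chi \in \widehat{G}_{\mathbb{C}}$, $a_\chi \neq 0$. Sums over $\chi$ weighted by $a_\chi$ involve only those $\chi$ with $a_\chi \neq 0$. Fermionic variables: $u_1,\dots,u_n,v_1,\dots,v_n$ are the generators of the exterior algebra $\wedge_R^\bullet(M^1)$ of the free $R$-module $M^1$ with this basis. Thus they pairwise anticommute ($u_iu_j=-u_ju_i$, $v_iv_j=-v_jv_i$, $u_iv_j=-v_ju_i$) and $u_j^2 = v_j^2 = 0$. The products $u_iv_j$ are even and commute with one another, and $f(tu_jv_j) = f_0 + f_1 t u_j v_j$. For $J \subseteq [n]$, $\mathbf{u}^J := \prod_{j \in J} u_j$ and $\mathbf{v}^J := \prod_{j\in J} v_j$, with factors in increasing order of index. The identity is in $\wedge_R^\bullet(M^1)[[t]]$, with $t$ commuting with everything and operators acting coefficientwise in $t$. Each $g \in S_2 \wr S_n$ is written $g = D_g\sigma_g$, with $D_g$ diagonal with diagonal entries $(D_g)_i \in \{\pm1\}$ and $\sigma_g \in S_n$ a permutation (matrix). $g^{\mathbf{u}}$ is the $R$-algebra automorphism of $\wedge_R^\bullet(M^1)$ with $u_i \mapsto (D_g)_{\sigma_g(i)} u_{\sigma_g(i)}$ and fixing every $v_j$; $g^{\mathbf{v}}$ is defined in the same way on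 the $v$-variables, fixing every $u_i$. For $\chi \in \widehat{G}_{\mathbb{C}}$, $E_\chi := \chi(1)\sum_{g\in G}\chi(g) g^{-1}$, and $E_\chi^{\mathbf{u}}$, $E_\chi^{\mathbf{v}}$ denote its actions through $g \mapsto g^{\mathbf{u}}$ and $g\mapsto g^{\mathbf{v}}$ respectively. $\overline{\chi}$ is the complex conjugate character of $\chi$. Finally $E_\psi^{\mathbf{u}} := \sum_\chi a_\chi E_\chi^{\mathbf{u}}$, $\overline{\psi} := \sum_\chi a_\chi \overline{\chi}$ (with $a_\chi$, not its complex conjugate), and $E_{\overline{\psi}}^{\mathbf{v}} := \sum_\chi a_\chi E_{\overline{\chi}}^{\mathbf{v}}$. *)

(* Defs.v *)
From HB Require Import structures.
From mathcomp Require Import boolp classical_sets functions reals.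
From mathcomp Require Import all_boot all_order all_fingroup all_algebra.
From mathcomp Require Import mxrepresentation.
From mathcomp Require Import ring.
From mathcomp.real_closed Require Import complex.

Set Implicit Arguments.
Unset Strict Implicit.
Unset Printing Implicit Defensive.

Import Order.TTheory GRing.Theory Num.Theory.

Local Open Scope ring_scope.

(* A pair (D, s) stands for the signed permutation matrix D * P_s, where D is
   diagonal with i-th entry (-1) ^+ (D i), and P_s e_i = e_(s i). *)
Definition signed_perm (n : nat) : Type := ({ffun 'I_n -> bool} * 'S_n)%type.

HB.instance Definition _ n := Finite.on (signed_perm n).

Section SignedPerm.
Variable n : nat.
Implicit Types g h : signed_perm n.

(* D P_s D' P_s' = D (P_s D' P_s^-1) (P_s P_s'); in {perm _}, s' * s denotes
   s' followed by s. *)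
Definition sp_mul g h : signed_perm n :=
  ([ffun i => g.1 i (+) h.1 ((g.2^-1)%g i)], (h.2 * g.2)%g).
Definition sp_one : signed_perm n := ([ffun=> false], 1%g).
Definition sp_inv g : signed_perm n := ([ffun i => g.1 (g.2 i)], (g.2^-1)%g).

Fact sp_mulA : associative sp_mul.
Proof.
move=> g h k; congr pair => /=; last by rewrite mulgA.
by apply/ffunP=> i; rewrite !ffunE /= invMg permM addbA.
Qed.

Fact sp_mul1 : left_id sp_one sp_mul.
Proof.
case=> D s; congr pair => /=; last by rewrite mulg1.
by apply/ffunP=> i; rewrite !ffunE /= invg1 perm1.
Qed.

Fact sp_mulV : left_inverse sp_one sp_inv sp_mul.
Proof.
case=> D s; congr pair => /=; last by rewrite mulgV.
by apply/ffunP=> i; rewrite !ffunE /= invgK addbb.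
Qed.

HB.instance Definition _ :=
  Finite_isGroup.Build (signed_perm n) sp_mulA sp_mul1 sp_mulV.

(* Matrix of g acting on column vectors: column i is (D_g)_(s i) e_(s i). *)
Definition sp_mx (g : signed_perm n) : 'M[int]_n :=
  \matrix_(i, j) ((-1) ^+ (g.1 i) *+ (i == g.2 j)).

Lemma sp_mxM g h : sp_mx (g * h)%g = sp_mx g *m sp_mx h.
Proof.
apply/matrixP=> i k; rewrite !mxE /= (bigD1 (h.2 k)) //= big1 => [|j nj].
  rewrite !mxE eqxx addr0 permM ffunE.
  case: eqP => [->|]; last by rewrite !mulr0n mul0r.
  by rewrite permK signr_addb.
by rewrite !mxE (negPf nj) mulr0n mulr0.
Qed.

Lemma sp_mx_inj : injective sp_mx.
Proof.
case=> D s [D' s'] /matrixP e.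
have es : s = s'.
  apply/permP=> j; have := e (s j) j; rewrite !mxE /= eqxx.
  by case: (s j =P s' j) => // _ /eqP; rewrite signr_eq0.
subst s'; congr pair; apply/ffunP=> i; have := e i ((s^-1)%g i).
by rewrite !mxE /= permKV eqxx; case: (D i); case: (D' i).
Qed.

End SignedPerm.

(* The exterior algebra of the free R-module with basis e_0, ..., e_(m-1): an
   element is the family of its coordinates on the basis of the
   e_S = e_(i_1) ... e_(i_k), with S = {i_1 < ... < i_k}. *)
Definition extalg (R : comPzRingType) (m : nat) : Type :=
  {ffun {set 'I_m} -> R^o}.

Section ExteriorAlgebra.
Variables (R : comPzRingType) (m : nat).
Local Notation ext := (extalg R m).
Implicit Types (x y z : ext) (A B S : {set 'I_m}).

HB.instance Definition _ :=
  GRing.Lmodule.copy (extalg R m) {ffun {set 'I_m} -> R^o}.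

(* Number of inversions in the concatenation of A and B, so that
   e_A * e_B = (-1) ^+ inv_count A B *: e_(A :|: B) for disjoint A and B. *)
Definition inv_count A B : nat := (\sum_(a in A) \sum_(b in B) (b < a))%N.

Definition ext_basis S : ext := [ffun A : {set 'I_m} => (A == S)%:R].

Definition ext_one : ext := ext_basis set0.

Definition ext_mul x y : ext :=
  [ffun S : {set 'I_m} => \sum_(A : {set 'I_m} | A \subset S)
     (-1) ^+ inv_count A (S :\: A) * (x A * y (S :\: A))].

Lemma sum_disjU (F : 'I_m -> nat) A B : [disjoint A & B] ->
  (\sum_(i in A :|: B) F i = \sum_(i in A) F i + \sum_(i in B) F i)%N.
Proof. by move=> d; rewrite -bigU //=; apply: eq_bigl => i; rewrite !inE. Qed.

Lemma inv_countUl A B S : [disjoint A & B] ->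
  inv_count (A :|: B) S = (inv_count A S + inv_count B S)%N.
Proof. by move=> d; rewrite /inv_count sum_disjU. Qed.

Lemma inv_countUr A B S : [disjoint A & B] ->
  inv_count S (A :|: B) = (inv_count S A + inv_count S B)%N.
Proof.
move=> d; rewrite /inv_count -big_split /=.
by apply: eq_bigr => a _; rewrite sum_disjU.
Qed.

Lemma inv_count0l A : inv_count set0 A = 0%N.
Proof. by rewrite /inv_count big_set0. Qed.

Lemma inv_count0r A : inv_count A set0 = 0%N.
Proof. by rewrite /inv_count big1 // => a _; rewrite big_set0. Qed.

Fact ext_mulA : associative ext_mul.
Proof.
move=> x y z; apply/ffunP=> S; rewrite !ffunE.
transitivity (\sum_(A : {set 'I_m} | A \subset S)
   \sum_(T : {set 'I_m} | (A \subset T) && (T \subset S))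
     (-1) ^+ inv_count A (S :\: A) * (x A *
       ((-1) ^+ inv_count (T :\: A) (S :\: T) *
        (y (T :\: A) * z (S :\: T))))).
  apply: eq_bigr => A AS; rewrite ffunE !mulr_sumr.
  rewrite (reindex_onto (fun T => T :\: A) (fun B => A :|: B)) /=; last first.
    move=> B; rewrite subsetD => /andP[_ d].
    rewrite setDUl setDv set0U; apply/setDidPl.
    by [].
  apply: eq_big => T.
    have UD B : A :|: B :\: A = A :|: B by rewrite setDE setUIr setUCr setIT.
    rewrite subDset !UD (setUidPr AS) andbC; congr (_ && _).
    exact/eqP/setUidPr.
  move=> /andP[TS /eqP e].
  have -> // : S :\: A :\: (T :\: A) = S :\: T.
  by rewrite setDDl e.
rewrite (exchange_big_dep (fun T : {set 'I_m} => T \subset S)) /=; last first.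
  by move=> A T _ /andP[].
apply: eq_bigr => T TS; rewrite ffunE mulr_suml mulr_sumr.
apply: eq_big => A; first by case AT: (A \subset T); rewrite ?TS ?andbF //= ?(subset_trans AT TS).
move=> /andP[AS /andP[AT _]].
have eS : S :\: A = (T :\: A) :|: (S :\: T).
  apply/setP=> i; rewrite !inE; have := subsetP AT i; have := subsetP TS i.
  by case: (i \in A); case: (i \in T); case: (i \in S) => //= h1 h2; 
     rewrite ?h1 ?h2 //; do ?[have := h1 isT | have := h2 isT].
have eT : T = A :|: (T :\: A) by rewrite -[LHS](setID T A) (setIidPr AT).
have d1 : [disjoint T :\: A & S :\: T].
  by rewrite -setI_eq0; apply/eqP/setP=> i; rewrite !inE; case: (i \in T); rewrite ?andbF.
have d2 : [disjoint A & T :\: A].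
  by rewrite -setI_eq0; apply/eqP/setP=> i; rewrite !inE; case: (i \in A).
have -> : inv_count T (S :\: T) =
    (inv_count A (S :\: T) + inv_count (T :\: A) (S :\: T))%N.
  by rewrite {1}eT inv_countUl.
rewrite eS inv_countUr // !exprD.
move: (_ ^+ _) (_ ^+ _) (_ ^+ _) (x _) (y _) (z _) => a b c p q r.
by rewrite -!mulrA; ring.
Qed.

Fact ext_mul1l : left_id ext_one ext_mul.
Proof.
move=> x; apply/ffunP=> S; rewrite ffunE (bigD1 set0) ?sub0set //=.
rewrite setD0 inv_count0l expr0 !mul1r ffunE eqxx mul1r big1 ?addr0 //.
by move=> A /andP[_ /negPf nA]; rewrite ffunE nA mul0r mulr0.
Qed.

Fact ext_mul1r : right_id ext_one ext_mul.
Proof.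
move=> x; apply/ffunP=> S; rewrite ffunE (bigD1 S) //=.
rewrite setDv inv_count0r expr0 !mul1r ffunE eqxx mulr1 big1 ?addr0 //.
move=> A /andP[AS nA]; rewrite ffunE setD_eq0.
case SA: (S \subset A); last by rewrite !mulr0.
by rewrite eqEsubset AS SA in nA.
Qed.

Fact ext_mulDl : left_distributive ext_mul +%R.
Proof.
move=> x y z; apply/ffunP=> S; rewrite !ffunE -big_split /=.
by apply: eq_bigr => A _; rewrite ffunE mulrDl mulrDr.
Qed.

Fact ext_mulDr : right_distributive ext_mul +%R.
Proof.
move=> x y z; apply/ffunP=> S; rewrite !ffunE -big_split /=.
by apply: eq_bigr => A _; rewrite ffunE !mulrDr.
Qed.

HB.instance Definition _ := GRing.Zmodule_isPzRing.Build (extalg R m)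
  ext_mulA ext_mul1l ext_mul1r ext_mulDl ext_mulDr.

Lemma ext_scaleAl (c : R) x y : c *: (x * y) = (c *: x) * y.
Proof.
apply/ffunP=> S; rewrite !ffunE scaler_sumr; apply: eq_bigr => A _.
by rewrite ffunE; rewrite /GRing.scale /=; ring.
Qed.

Lemma ext_scaleAr (c : R) x y : c *: (x * y) = x * (c *: y).
Proof.
apply/ffunP=> S; rewrite !ffunE scaler_sumr; apply: eq_bigr => A _.
by rewrite ffunE; rewrite /GRing.scale /=; ring.
Qed.

Definition ext_gen (i : 'I_m) : ext := ext_basis [set i].

Lemma ext_basis_mul A B : ext_basis A * ext_basis B =
  if [disjoint A & B] then (-1) ^+ inv_count A B *: ext_basis (A :|: B) else 0.
Proof.
apply/ffunP=> S; rewrite [LHS]ffunE.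
have -> : (\sum_(C : {set 'I_m} | C \subset S) (-1) ^+ inv_count C (S :\: C) *
     (ext_basis A C * ext_basis B (S :\: C))) =
   (if (A \subset S) && (S :\: A == B) then (-1) ^+ inv_count A B else 0 : R^o).
  case AS: (A \subset S) => /=; last first.
    rewrite big1 // => C CS; rewrite !ffunE.
    by case: eqP CS => [->|]; rewrite ?AS // mul0r mulr0.
  rewrite (bigD1 A) //= !ffunE eqxx mul1r big1 => [|C /andP[_ nC]].
    by case: eqP => [->|]; rewrite ?mulr1 ?mulr0 addr0.
  by rewrite ffunE (negPf nC) mul0r mulr0.
have -> : (A \subset S) && (S :\: A == B) = [disjoint A & B] && (S == A :|: B).
  apply/andP/andP => [[AS /eqP <-]|[d /eqP ->]].
    split; last by rewrite setDE setUIr setUCr setIT (setUidPr AS).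
    by rewrite -setI_eq0; apply/eqP/setP=> i; rewrite !inE; case: (i \in A).
  rewrite subsetUl setDUl setDv set0U; split=> //; apply/eqP/setDidPl.
  by rewrite disjoint_sym.
case: [disjoint _ & _]; rewrite ?ffunE //=.
by case: eqP => _; rewrite /GRing.scale /= ?mulr1 ?mulr0.
Qed.

Lemma ext_gen_sqr i : ext_gen i * ext_gen i = 0.
Proof. by rewrite ext_basis_mul disjoints1 inE eqxx. Qed.

Lemma ext_gen_anticomm i j : ext_gen i * ext_gen j = - (ext_gen j * ext_gen i).
Proof.
have [->|nij] := eqVneq i j; first by rewrite ext_gen_sqr oppr0.
rewrite !ext_basis_mul !disjoints1 !inE [j == i]eq_sym nij setUC -scaleNr.
congr (_ *: _); rewrite /inv_count !big_set1.
case: ltngtP nij => [_ _|_ _|/val_inj-> /eqP //].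
  by rewrite expr0 expr1.
by rewrite expr0 expr1 opprK.
Qed.

Lemma ext_basis_prod S : \prod_(i in S) ext_gen i = ext_basis S.
Proof.
have H (s : seq 'I_m) : sorted (fun i j : 'I_m => i < j)%N s ->
    \prod_(i <- s) ext_gen i = ext_basis [set i in s].
  elim: s => [|i s IHs] /= ss.
    by rewrite big_nil; congr ext_basis; apply/setP=> i; rewrite !inE.
  rewrite big_cons IHs ?(path_sorted ss) // ext_basis_mul.
  have lt j : j \in s -> (i < j)%N.
    move=> js; move: ss; rewrite path_sortedE.
      by case/andP=> /allP /(_ j js).
    by move=> a b c; apply: ltn_trans.
  rewrite disjoints1 inE.
  case: (boolP (i \in s)) => [/lt|_]; first by rewrite ltnn.
  rewrite /inv_count big_set1 big1 => [|j].
    by rewrite expr0 scale1r; congr ext_basis; apply/setP=> j; rewrite !inE.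
  by rewrite inE => /lt; case: ltngtP.
rewrite -big_filter deprecated_filter_index_enum H; first by congr ext_basis; apply/setP=> i; rewrite inE mem_enum.
rewrite /enum_mem -enumT; apply: sorted_filter.
  by move=> a b c; apply: ltn_trans.
have := iota_ltn_sorted 0 m; rewrite -val_enum_ord sorted_map.
by apply: sub_sorted.
Qed.

Lemma ext_sumE x : x = \sum_(S : {set 'I_m}) x S *: ext_basis S.
Proof.
apply/ffunP=> S; rewrite sum_ffunE (bigD1 S) //= big1 => [|T nTS].
  by rewrite addr0 !ffunE eqxx /GRing.scale /= mulr1.
by rewrite !ffunE eq_sym (negPf nTS) /GRing.scale /= mulr0.
Qed.

(* The R-linear map sending e_(i_1) ... e_(i_k), with i_1 < ... < i_k, to
   h i_1 * ... * h i_k; when the h i square to 0 and pairwise anticommute it is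
   the R-algebra endomorphism with e_i |-> h i. *)
Definition ext_lift (h : 'I_m -> ext) (x : ext) : ext :=
  \sum_(S : {set 'I_m}) x S *: \prod_(i in S) h i.

Lemma ext_lift1 h : ext_lift h 1 = 1.
Proof.
rewrite /ext_lift (bigD1 set0) //= [X in _ + X]big1 => [|S nS].
  by rewrite addr0 ffunE eqxx scale1r big_set0.
by rewrite ffunE (negPf nS) scale0r.
Qed.

End ExteriorAlgebra.

Section ExtLift.
Variables (R : comPzRingType) (m : nat).
Local Notation ext := (extalg R m).
Variable h : 'I_m -> ext.
Implicit Types (x y : ext) (A B S : {set 'I_m}).

Fact ext_lift_linear (c : R) x y :
  ext_lift h (c *: x + y) = c *: ext_lift h x + ext_lift h y.
Proof.
rewrite /ext_lift scaler_sumr -big_split /=; apply: eq_bigr => S _.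
by rewrite !ffunE scalerDl scalerA.
Qed.

HB.instance Definition _ :=
  GRing.isLinear.Build R ext ext _ (ext_lift h) ext_lift_linear.

Lemma ext_lift_basis S : ext_lift h (ext_basis R S) = \prod_(i in S) h i.
Proof.
rewrite /ext_lift (bigD1 S) //= [X in _ + X]big1 => [|T nTS].
  by rewrite addr0 ffunE eqxx scale1r.
by rewrite ffunE (negPf nTS) scale0r.
Qed.

Lemma ext_lift_gen i : ext_lift h (ext_gen R i) = h i.
Proof. by rewrite ext_lift_basis big_set1. Qed.

Hypothesis h_sqr : forall i, h i * h i = 0.
Hypothesis h_anticomm : forall i j, h i * h j = - (h j * h i).

Lemma prod_set_cons (i : 'I_m) S : (forall j, j \in S -> i < j)%N ->
  \prod_(k in i |: S) h k = h i * \prod_(k in S) h k.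
Proof.
move=> lt; rewrite -!(big_filter (index_enum _)) !deprecated_filter_index_enum.
have srt A : sorted (fun i j : 'I_m => i < j)%N (enum A).
  rewrite /enum_mem -enumT; apply: sorted_filter.
    by move=> a b c; apply: ltn_trans.
  have := iota_ltn_sorted 0 m; rewrite -val_enum_ord sorted_map.
  by apply: sub_sorted.
have -> : enum (i |: S) = i :: enum S; last by rewrite big_cons.
apply: (irr_sorted_eq (leT := fun i j : 'I_m => (i < j)%N)).
- by move=> a b c; apply: ltn_trans.
- by move=> a; rewrite ltnn.
- exact: srt.
- rewrite /= path_sortedE ?srt ?andbT; last by move=> a b c; apply: ltn_trans.
  by apply/allP=> j; rewrite mem_enum => /lt.
- by move=> j; rewrite inE !mem_enum !inE.
Qed.

Lemma set_minP S : S != set0 ->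
  exists i B, [/\ S = i |: B, i \notin B & forall j, j \in B -> (i < j)%N].
Proof.
case/set0Pn=> i0 Si0; case: (arg_minnP (fun i : 'I_m => i : nat) Si0) => i Si le.
exists i, (S :\ i); split; rewrite ?setD1K ?setD11 // => j.
rewrite !inE => /andP[nji /le]; rewrite leq_eqVlt => /predU1P[/val_inj e|//].
by rewrite e eqxx in nji.
Qed.

Lemma mul_gen_prod i B : h i * \prod_(k in B) h k =
  if i \in B then 0
  else (-1) ^+ inv_count [set i] B *: \prod_(k in i |: B) h k.
Proof.
have [N] := ubnP #|B|; elim: N => // N IHN in B *; rewrite ltnS => leN.
have [->|/set_minP[b [B' [eB nbB' lt]]]] := eqVneq B set0.
  by rewrite inE inv_count0r expr0 scale1r prod_set_cons // => j; rewrite inE.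
rewrite eB (prod_set_cons lt) mulrA !inE.
have [<-|nib] /= := eqVneq i b; first by rewrite h_sqr mul0r.
rewrite h_anticomm mulNr -mulrA IHN; last first.
  by apply: leq_trans leN; rewrite eB cardsU1 nbB'.
case: (boolP (i \in B')) => [iB'|niB']; first by rewrite mulr0 oppr0.
have dbB : [disjoint [set b] & B'] by rewrite disjoints1.
rewrite inv_countUr // {2}/inv_count !big_set1.
case: (ltngtP b i) nib => [bi _|ib _|/val_inj->]; last by rewrite eqxx.
  rewrite exprD expr1 -ext_scaleAr mulN1r scaleNr; congr (- (_ *: _)).
  rewrite -prod_set_cons; first by rewrite setUCA.
  by move=> j; rewrite !inE => /predU1P[->//|/lt].
have e : inv_count [set i] B' = 0%N.
  rewrite /inv_count big_set1 big1 // => j /lt bj.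
  by case: ltngtP (ltn_trans ib bj).
rewrite e !expr0 !scale1r prod_set_cons; last first.
  by move=> j jB; apply: ltn_trans ib (lt _ jB).
rewrite (prod_set_cons (i := i)); last first.
  by move=> j; rewrite !inE => /predU1P[->//|/lt]; apply: ltn_trans.
by rewrite (prod_set_cons lt) !mulrA [h i * h b]h_anticomm mulNr.
Qed.

Lemma prod_prod A B :
  \prod_(i in A) h i * \prod_(i in B) h i =
  if [disjoint A & B] then
    (-1) ^+ inv_count A B *: \prod_(i in A :|: B) h i else 0.
Proof.
have [N] := ubnP #|A|; elim: N => // N IHN in A *; rewrite ltnS => leN.
have [->|/set_minP[a [A' [eA naA' lt]]]] := eqVneq A set0.
  by rewrite big_set0 mul1r -setI_eq0 set0I eqxx inv_count0l expr0 scale1r set0U.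
rewrite eA (prod_set_cons lt) -mulrA IHN; last first.
  by apply: leq_trans leN; rewrite eA cardsU1 naA'.
have -> : [disjoint a |: A' & B] = (a \notin B) && [disjoint A' & B].
  by rewrite -!setI_eq0 setIUl setU_eq0 !setI_eq0 disjoints1.
case: ifP => dAB; last by rewrite mulr0 andbF.
rewrite andbT -ext_scaleAr mul_gen_prod inE (negPf naA') /=.
case: (boolP (a \in B)) => [|naB]; first by rewrite scaler0.
rewrite scalerA -exprD setUA; congr (_ ^+ _ *: _).
rewrite inv_countUl ?disjoints1 // inv_countUr //.
suff -> : inv_count [set a] A' = 0%N by rewrite add0n addnC.
by rewrite /inv_count big_set1 big1 // => j /lt; case: ltngtP.
Qed.

Lemma ext_liftM x y : ext_lift h (x * y) = ext_lift h x * ext_lift h y.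
Proof.
rewrite {1}[x]ext_sumE mulr_suml linear_sum [in RHS]/ext_lift mulr_suml.
apply: eq_bigr => A _; rewrite -ext_scaleAl linearZ -ext_scaleAl.
congr (_ *: _); rewrite {1}[y]ext_sumE mulr_sumr linear_sum /= mulr_sumr.
apply: eq_bigr => B _; rewrite -!ext_scaleAr linearZ; congr (_ *: _).
rewrite prod_prod ext_basis_mul /=.
by case: ifP => _; rewrite ?linear0 // linearZ /= ext_lift_basis.
Qed.
End ExtLift.

Definition fps (A : Type) : Type := nat -> A.

HB.instance Definition _ (A : zmodType) := GRing.Zmodule.copy (fps A) (nat -> A).
HB.instance Definition _ (R : pzRingType) (A : lmodType R) :=
  GRing.Lmodule.copy (fps A) (nat -> A).

Section PowerSeries.
Variable A : pzRingType.
Implicit Types p q r : fps A.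

Definition fps_const (c : A) : fps A := fun M => if M == 0%N then c else 0.
Definition fps_var : fps A := fun M => (M == 1%N)%:R.
Definition fps_mul p q : fps A := fun M => \sum_(k < M.+1) p k * q (M - k)%N.

Lemma fps_mul_rev p q M : fps_mul p q M = \sum_(k < M.+1) p (M - k)%N * q k.
Proof.
rewrite /fps_mul (reindex_inj rev_ord_inj) /=.
by apply: eq_bigr => k _; rewrite subSS subKn // -ltnS.
Qed.

Fact fps_mulA : associative fps_mul.
Proof.
move=> p q r; apply/funext=> M; rewrite [RHS]fps_mul_rev [LHS]/fps_mul.
pose c3 j k := p j * (q (M - j - k)%N * r k).
transitivity (\sum_(j < M.+1) \sum_(k < M.+1 | (k <= M - j)%N) c3 j k).
  apply: eq_bigr => /= j _; rewrite fps_mul_rev big_distrr /=.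
  by rewrite (big_ord_narrow_leq (leq_subr _ _)).
rewrite (exchange_big_dep predT) //=; apply: eq_bigr => k _.
transitivity (\sum_(j < M.+1 | (j <= M - k)%N) c3 j k).
  apply: eq_bigl => j; rewrite -ltnS -(ltnS j) -!subSn ?leq_ord //.
  by rewrite -subn_gt0 -(subn_gt0 j) -!subnDA addnC.
rewrite (big_ord_narrow_leq (leq_subr _ _)) /fps_mul big_distrl /=.
by apply: eq_bigr => j _; rewrite /c3 -!subnDA addnC mulrA.
Qed.

Fact fps_mul1l : left_id (fps_const 1) fps_mul.
Proof.
move=> p; apply/funext=> M; rewrite /fps_mul big_ord_recl big1 => [|k _].
  by rewrite /fps_const eqxx mul1r subn0 addr0.
by rewrite /fps_const /= mul0r.
Qed.

Fact fps_mul1r : right_id (fps_const 1) fps_mul.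
Proof.
move=> p; apply/funext=> M; rewrite /fps_mul big_ord_recr /= big1 => [|k _].
  by rewrite /fps_const subnn eqxx mulr1 add0r.
by rewrite /fps_const subn_eq0 leqNgt ltn_ord mulr0.
Qed.

Fact fps_mulDl : left_distributive fps_mul +%R.
Proof.
move=> p q r; apply/funext=> M.
rewrite -[RHS]/(fps_mul p r M + fps_mul q r M) /fps_mul -big_split /=.
by apply: eq_bigr => k _; rewrite -mulrDl.
Qed.

Fact fps_mulDr : right_distributive fps_mul +%R.
Proof.
move=> p q r; apply/funext=> M.
rewrite -[RHS]/(fps_mul p q M + fps_mul p r M) /fps_mul -big_split /=.
by apply: eq_bigr => k _; rewrite -mulrDr.
Qed.

HB.instance Definition _ := GRing.Zmodule_isPzRing.Build (fps A)
  fps_mulA fps_mul1l fps_mul1r fps_mulDl fps_mulDr.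

End PowerSeries.

(* The series f(t x), for x commuting with t. *)
Definition fps_at (R : comPzRingType) m (f : fps R) (x : extalg R m) :
  fps (extalg R m) := fun M => f M *: x ^+ M.

(* Coefficientwise extension of an operator. *)
Definition fps_map (A B : Type) (L : A -> B) (p : fps A) : fps B :=
  fun M => L (p M).

Section GeneratedSubring.
Variables (C : comNzRingType) (S : set C).

Definition gen_subring_pred : {pred C} :=
  fun x => x \in smallest (fun P : set C => subring_closed (mem P)) S.

Lemma mem_gen_subring x : S x -> x \in gen_subring_pred.
Proof. by move=> Sx; apply/mem_set => P [_]; apply. Qed.

Fact gen_subring_closed : subring_closed gen_subring_pred.
Proof.
split=> [|x y|x y]; rewrite !unfold_in.
- by apply/mem_set => P /= [[P1 _ _] _]; apply/set_mem.
- move=> /set_mem Hx /set_mem Hy; apply/mem_set => P /= HP.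
  case: (HP) => [[_ PB _] _]; apply/set_mem/PB; apply/mem_set.
    exact: Hx.
  exact: Hy.
- move=> /set_mem Hx /set_mem Hy; apply/mem_set => P /= HP.
  case: (HP) => [[_ _ PM] _]; apply/set_mem/PM; apply/mem_set.
    exact: Hx.
  exact: Hy.
Qed.

HB.instance Definition _ :=
  GRing.isSubringClosed.Build C gen_subring_pred gen_subring_closed.

(* The unital subring of C generated by S. *)
Record gen_subring : Type :=
  GenSubring { gen_subring_val : C; _ : gen_subring_val \in gen_subring_pred }.

HB.instance Definition _ := [isSub for gen_subring_val].
HB.instance Definition _ := [Choice of gen_subring by <:].
HB.instance Definition _ := [SubChoice_isSubComNzRing of gen_subring by <:].

End GeneratedSubring.

Section Characters.
Variables (K : realType) (gT : finGroupType) (G : {group gT}).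
Local Notation C := (complex K).

(* Isomorphism classes of irreducible complex representations of G; they are
   in bijection with the irreducible characters via irr_char. *)
Definition irr_index : irrType C G := DecSocleType (regular_repr C G).

Definition irr_char (i : irr_index) (g : gT) : C := \tr (irr_repr i g).

Definition conj_fun (phi : gT -> C) (g : gT) : C := (phi g)^*.

Definition is_class_fun (psi : gT -> C) : Prop :=
  {in G &, forall g h, psi (g ^ h)%g = psi g}.

(* psi = \sum_chi a_chi chi. *)
Definition irr_expansion (psi : gT -> C) (a : irr_index -> C) : Prop :=
  {in G, forall g, psi g = \sum_(i : irr_index) a i * irr_char i g}.

Definition Rpsi_gens (a : irr_index -> C) : set C :=
  [set z | (exists i, z = a i) \/
           (exists i g, [/\ a i != 0, g \in G & z = irr_char i g])]%classic.

Definition Rpsi (a : irr_index -> C) : Type := gen_subring (Rpsi_gens a).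

HB.instance Definition _ a := GRing.ComNzRing.on (Rpsi a).

Lemma mem_Rpsi_coef a i : a i \in gen_subring_pred (Rpsi_gens a).
Proof. by apply: mem_gen_subring; left; exists i. Qed.

Lemma mem_Rpsi_char a i g : a i != 0 -> g \in G ->
  irr_char i g \in gen_subring_pred (Rpsi_gens a).
Proof. by move=> ai Gg; apply: mem_gen_subring; right; exists i, g. Qed.

(* The standard invariant Hermitian form argument. *)
Lemma conj_irr_char i g : g \in G ->
  conj_fun (irr_char i) g = irr_char i (g^-1)%g.
Proof.
move=> Gg; rewrite /conj_fun /irr_char; move: (irr_repr i).
move: (irr_degree i) => d rho.
pose cj (M : 'M[C]_d) : 'M[C]_d := (map_mx (fun z : C => z^*) M)^T.
have cjM (M N : 'M_d) : cj (M *m N) = cj N *m cj M.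
  apply/matrixP=> r s; rewrite !mxE rmorph_sum; apply: eq_bigr => k _.
  by rewrite !mxE rmorphM mulrC.
pose H : 'M[C]_d := \sum_(h in G) rho h *m cj (rho h).
have HE : rho g *m H *m cj (rho g) = H.
  rewrite /H mulmx_sumr mulmx_suml [RHS](reindex_inj (mulgI g)) /=.
  apply: eq_big => h; first by rewrite groupMl.
  by move=> Gh; rewrite repr_mxM // cjM !mulmxA.
have Hu : H \in unitmx.
  rewrite -row_free_unit -kermx_eq0; apply/eqP/row_matrixP => r.
  rewrite row0; set v := row r _.
  have vH : v *m H = 0 by apply/eqP; rewrite -sub_kermx row_sub.
  pose w h := v *m rho h.
  have w2 h j : 0 <= w h 0 j * (w h 0 j)^* by apply: mul_conjC_ge0.
  have : \sum_(h in G) \sum_j w h 0 j * (w h 0 j)^* = 0.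
    transitivity ((v *m H *m (map_mx (fun z : C => z^*) v)^T) 0 0).
      rewrite /H mulmx_sumr mulmx_suml summxE; apply: eq_bigr => h _.
      rewrite mulmxA -[_ *m cj _ *m _]mulmxA mxE; apply: eq_bigr => j _.
      congr (_ * _); rewrite [RHS]mxE /w mxE rmorph_sum; apply: eq_bigr => k _.
      by rewrite !mxE rmorphM mulrC.
    by rewrite vH mul0mx mxE.
  move/eqP; rewrite psumr_eq0 => [/allP/(_ 1%g)|h _]; last exact: sumr_ge0.
  rewrite mem_index_enum group1 /= => /(_ isT).
  rewrite psumr_eq0 // => /allP H0; apply/rowP=> j.
  have := H0 j; rewrite mem_index_enum /= mul_conjC_eq0 /w repr_mx1 mulmx1 mxE.
  by move=> /(_ isT)/eqP ->; rewrite mxE.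
have trE : cj (rho g) = invmx H *m rho (g^-1)%g *m H.
  by rewrite -{2}HE !mulmxA repr_mxKV // mulVmx // mul1mx.
have -> : (\tr (rho g))^* = \tr (cj (rho g)).
  by rewrite rmorph_sum; apply: eq_bigr => k _; rewrite !mxE.
by rewrite trE mxtrace_mulC mulmxA mulmxV // mul1mx.
Qed.

Lemma mem_Rpsi_conj a i g : a i != 0 -> g \in G ->
  conj_fun (irr_char i) g \in gen_subring_pred (Rpsi_gens a).
Proof. by move=> ai Gg; rewrite conj_irr_char // mem_Rpsi_char ?groupV. Qed.

End Characters.

Section Actions.
Variables (R : comPzRingType) (n : nat).
(* u_1, ..., u_n are the first n generators, v_1, ..., v_n the last n. *)
Local Notation ext := (extalg R (n + n)).
Implicit Types (J : {set 'I_n}) (g : signed_perm n).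

Definition ugen (i : 'I_n) : ext := ext_gen R (lshift n i).
Definition vgen (i : 'I_n) : ext := ext_gen R (rshift n i).

Definition uprod J : ext := \prod_(j in J) ugen j.
Definition vprod J : ext := \prod_(j in J) vgen j.

Definition uact g : ext -> ext := ext_lift (fun k =>
  match split k with
  | inl i => (-1) ^+ (g.1 (g.2 i)) *: ugen (g.2 i)
  | inr j => vgen j
  end).

Definition vact g : ext -> ext := ext_lift (fun k =>
  match split k with
  | inl i => ugen i
  | inr j => (-1) ^+ (g.1 (g.2 j)) *: vgen (g.2 j)
  end).

Lemma uact_ugen g i : uact g (ugen i) = (-1) ^+ (g.1 (g.2 i)) *: ugen (g.2 i).
Proof. by rewrite /uact ext_lift_gen; rewrite (unsplitK (inl i : 'I_n + 'I_n)). Qed.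

Lemma uact_vgen g j : uact g (vgen j) = vgen j.
Proof. by rewrite /uact ext_lift_gen; rewrite (unsplitK (inr j : 'I_n + 'I_n)). Qed.

Lemma vact_vgen g j : vact g (vgen j) = (-1) ^+ (g.1 (g.2 j)) *: vgen (g.2 j).
Proof. by rewrite /vact ext_lift_gen; rewrite (unsplitK (inr j : 'I_n + 'I_n)). Qed.

Lemma vact_ugen g i : vact g (ugen i) = ugen i.
Proof. by rewrite /vact ext_lift_gen; rewrite (unsplitK (inl i : 'I_n + 'I_n)). Qed.

Lemma uactM g : {morph uact g : x y / x * y}.
Proof.
move=> x y; apply: ext_liftM => [k|k l].
  case: split => i; last exact: ext_gen_sqr.
  by rewrite -ext_scaleAl -ext_scaleAr ext_gen_sqr !scaler0.
case: split => i; case: split => j; rewrite -?ext_scaleAl -?ext_scaleAr;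
  rewrite -?ext_scaleAl ?scalerA 1?mulrC -?scalerN ext_gen_anticomm //.
Qed.

Lemma vactM g : {morph vact g : x y / x * y}.
Proof.
move=> x y; apply: ext_liftM => [k|k l].
  case: split => i; first exact: ext_gen_sqr.
  by rewrite -ext_scaleAl -ext_scaleAr ext_gen_sqr !scaler0.
case: split => i; case: split => j; rewrite -?ext_scaleAl -?ext_scaleAr;
  rewrite -?ext_scaleAl ?scalerA 1?mulrC -?scalerN ext_gen_anticomm //.
Qed.

End Actions.

Section Operators.
Variables (K : realType) (n : nat) (G : {group signed_perm n}).
Variable a : irr_index K G -> complex K.
Variables (R : comPzRingType) (phi : {rmorphism Rpsi a -> R}).
Local Notation ext := (extalg R (n + n)).

(* Image in R of z \in R_psi. By the mem_Rpsi lemmas, the default value of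
   insubd is irrelevant for the scalars occurring below. *)
Definition Rpsi_img (z : complex K) : R := phi (insubd (0 : Rpsi a) z).

Definition E_op (act : signed_perm n -> ext -> ext)
    (chi : signed_perm n -> complex K) (w : ext) : ext :=
  Rpsi_img (chi 1%g) *: \sum_(g in G) Rpsi_img (chi g) *: act (g^-1)%g w.

Definition Eu (i : irr_index K G) : ext -> ext :=
  E_op (@uact R n) (irr_char i).

(* E_(chi bar) acting on the v-variables. *)
Definition Ev_bar (i : irr_index K G) : ext -> ext :=
  E_op (@vact R n) (conj_fun (irr_char i)).

Definition Eu_psi (w : ext) : ext :=
  \sum_(i : irr_index K G | a i != 0) Rpsi_img (a i) *: Eu i w.

Definition Ev_psibar (w : ext) : ext :=
  \sum_(i : irr_index K G | a i != 0) Rpsi_img (a i) *: Ev_bar i w.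

End Operators.

(* Main.v *)
(** The element F = prod_j f(t u_j v_j) is fixed by g^u g^v, since the signs of
    g cancel in each product u_j v_j; so g^u F = (g^-1)^v F, and E_chi^u and
    E_(chi bar)^v agree on F.  By Schur's lemma E_chi E_chi = |G| E_chi, whence
    |G| E_chi^u F = E_chi^u E_(chi bar)^v F.  Expanding F over the subsets J,
    with prod_(j in J) u_j v_j = (-1)^C(|J|,2) u^J v^J, the two operators act
    separately on u^J and v^J. *)
Require Import Defs.
From HB Require Import structures.
From mathcomp Require Import boolp classical_sets functions reals.
From mathcomp Require Import all_boot all_order all_fingroup all_algebra.
From mathcomp Require Import mxrepresentation.
From mathcomp.real_closed Require Import complex.

Set Implicit Arguments.
Unset Strict Implicit.
Unset Printing Implicit Defensive.

Import Order.TTheory GRing.Theory Num.Theory.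

Local Open Scope ring_scope.

(** * Schur averaging and the convolution of irreducible characters *)

(** The averaged matrix commutes with [rG], so Schur's lemma makes it scalar, and its trace
    determines the scalar. Multiplying by [d] stands in for a division that could fail in positive
    characteristic. *)
Lemma schur_average (F : fieldType) (gT : finGroupType) (G : {group gT})
    (d : nat) (rG : mx_representation F G d) (M : 'M_d) :
  mx_absolutely_irreducible rG ->
  (\sum_(g in G) rG g *m M *m rG g^-1%g) *+ d = (\tr M *+ #|G|)%:M.
Proof.
move=> absG; set S := \sum_(g in G) _.
have /is_scalar_mxP[c Sc] : is_scalar_mx S.
  apply: (mx_abs_irr_cent_scalar absG); apply/centgmxP=> h Gh.
  rewrite mulmx_suml mulmx_sumr [RHS](reindex_inj (mulgI h^-1%g)) /=.
  apply: eq_big => g; first by rewrite groupMl ?groupV.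
  move=> Gg; rewrite !mulmxA -repr_mxM ?groupM ?groupV // mulKVg.
  by rewrite -mulmxA -repr_mxM ?groupV // invMg invgK.
have trS : \tr S = \tr M *+ #|G|.
  rewrite raddf_sum /= -sumr_const; apply: eq_bigr => g Gg.
  by rewrite mxtrace_mulC mulmxA -repr_mxM ?groupV // mulVg repr_mx1 mul1mx.
by rewrite -trS Sc mxtrace_scalar raddfMn.
Qed.

(** Adding up over [i] the entries [(i, b)] of [schur_average] for [delta_mx i j] gives the entry
    [(j, b)] here; only [i = j] has nonzero trace. *)
Lemma repr_trace_average (F : fieldType) (gT : finGroupType)
    (G : {group gT}) (d : nat) (rG : mx_representation F G d) :
  mx_absolutely_irreducible rG ->
  (\sum_(g in G) \tr (rG g) *: rG g^-1%g) *+ d = #|G|%:R%:M.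
Proof.
move=> absG; apply/matrixP=> j b.
transitivity (\sum_i ((\sum_(g in G) rG g *m delta_mx i j *m rG g^-1%g) *+ d) i b).
  under [RHS]eq_bigr do rewrite mulmxnE summxE.
  rewrite sumrMnl exchange_big mulmxnE summxE; congr (_ *+ d).
  apply: eq_bigr => g Gg; rewrite mxE mulr_suml; apply: eq_bigr => i _.
  (* Factoring [delta_mx i j] through dimension one splits the entry into [rG g i i] times the entry
     [(j, b)] of [rG g^-1]. *)
  rewrite -(mul_delta_mx (0 : 'I_1)) -mulmxA -mulmxA -rowE mulmxA -colE.
  by rewrite mxE big_ord1 !mxE.
have tr_delta i : \tr (delta_mx i j) = (j == i)%:R :> F.
  rewrite -(mul_delta_mx (0 : 'I_1)) mxtrace_mulC mul_delta_mx_cond.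
  by rewrite raddfMn /= /mxtrace big_ord1 mxE.
under eq_bigr do rewrite schur_average // tr_delta mxE.
rewrite (bigD1 j) //= big1 => [|i /negPf nij]; last first.
  by rewrite eq_sym nij mul0rn mul0rn.
by rewrite addr0 eqxx mxE.
Qed.

(** Multiply [repr_trace_average] by [rG k] and take traces. *)
Lemma repr_trace_convolution (F : fieldType) (gT : finGroupType)
    (G : {group gT}) (d : nat) (rG : mx_representation F G d) k :
  mx_absolutely_irreducible rG -> k \in G ->
  (\sum_(g in G) \tr (rG g) * \tr (rG (g^-1 * k)%g)) *+ d
    = \tr (rG k) *+ #|G|.
Proof.
move=> absG Gk.
transitivity (\tr ((\sum_(g in G) \tr (rG g) *: rG g^-1%g) *+ d *m rG k)).
  rewrite -[in RHS]scaler_nat -scalemxAl linearZ /= mulmx_suml raddf_sum /=.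
  rewrite mulr_natl; congr (_ *+ d); apply: eq_bigr => g Gg.
  by rewrite repr_mxM ?groupV // -scalemxAl linearZ.
by rewrite repr_trace_average // mul_scalar_mx linearZ /= mulr_natl.
Qed.

Lemma irr_char_convolution (K : realType) (gT : finGroupType)
    (G : {group gT}) (i : irr_index K G) k : k \in G ->
  irr_char i 1%g * \sum_(g in G) irr_char i g * irr_char i (g^-1 * k)%g
    = irr_char i k *+ #|G|.
Proof.
move=> Gk; rewrite {1}/irr_char repr_mx1 mxtrace1 mulr_natl.
apply: repr_trace_convolution => //.
(* [complex K] is algebraically closed, so irreducibility is absolute. *)
exact/group_closure_closed_field/socle_irr.
Qed.

(** * The operators [E_op] with scalars in [R] *)

HB.instance Definition _ (R : comPzRingType) (n : nat) (g : signed_perm n) :=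
  GRing.Linear.copy (@uact R n g) (ext_lift _).
HB.instance Definition _ (R : comPzRingType) (n : nat) (g : signed_perm n) :=
  GRing.Linear.copy (@vact R n g) (ext_lift _).

Section ScalarOperators.
Variables (K : realType) (n : nat) (G : {group signed_perm n}).
Variable a : irr_index K G -> complex K.
Variables (R : comPzRingType) (phi : {rmorphism Rpsi a -> R}).
Local Notation ext := (extalg R (n + n)).

(** [Rpsi_img] sends scalars outside R_psi to a default, so it cannot be treated as a ring morphism.
    The identity is checked in [Rpsi a], which contains the character values on [G] because
    [a i != 0], and then pushed through [phi]. *)
Lemma Rpsi_img_convolution i k : a i != 0 -> k \in G ->
  Rpsi_img phi (irr_char i 1%g) *
    (\sum_(g in G) Rpsi_img phi (irr_char i g) *
       Rpsi_img phi (irr_char i (g^-1 * k)%g))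
  = Rpsi_img phi (irr_char i k) *+ #|G|.
Proof.
move=> ai Gk; have := irr_char_convolution i Gk.
have := fun g => @mem_Rpsi_char _ _ _ a i g ai.
(* Keeping [irr_char i] abstract prevents unification from unfolding it. *)
move: (irr_char i) => chi chiR conv.
(* Outside [G] the lift [x g] may be the default [0], hence the restriction in [valx]. *)
have [x imgx valx] : exists2 x : signed_perm n -> Rpsi a,
    forall g, Rpsi_img phi (chi g) = phi (x g) &
    {in G, forall g, gen_subring_val (x g) = chi g}.
  exists (fun g => insubd (0 : Rpsi a) (chi g)) => // g Gg.
  by apply: insubdK; apply: chiR.
suff xE : x 1%g * (\sum_(g in G) x g * x (g^-1 * k)%g) = x k *+ #|G|.
  rewrite !imgx -[RHS]rmorphMn -xE rmorphM rmorph_sum /=.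
  by congr (_ * _); apply: eq_bigr => g _; rewrite !imgx rmorphM.
apply: val_inj; rewrite rmorphM rmorph_sum rmorphMn /= !valx //.
rewrite -conv /=; congr (_ * _); apply: eq_bigr => g Gg.
by rewrite !valx // groupM ?groupV.
Qed.

Section GenericAction.
Variable act : signed_perm n -> {linear ext -> ext}.
Variable chi : signed_perm n -> complex K.
Local Notation E := (E_op phi (fun g => act g) chi).

Lemma E_op_linear : linear E.
Proof.
move=> c x y; rewrite /E_op scalerA mulrC -scalerA -scalerDr; congr (_ *: _).
rewrite scaler_sumr -big_split; apply: eq_bigr => g _ /=.
by rewrite linearP scalerDr !scalerA mulrC.
Qed.

Lemma E_op_mull z w : (forall g x, act g (z * x) = z * act g x) ->
  E (z * w) = z * E w.
Proof.
move=> actz; rewrite /E_op -ext_scaleAr mulr_sumr; congr (_ *: _).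
by apply: eq_bigr => g _; rewrite actz ext_scaleAr.
Qed.

Lemma E_op_mulr z w : (forall g x, act g (x * z) = act g x * z) ->
  E (w * z) = E w * z.
Proof.
move=> actz; rewrite /E_op -ext_scaleAl mulr_suml; congr (_ *: _).
by apply: eq_bigr => g _; rewrite actz ext_scaleAl.
Qed.

End GenericAction.

(** Grouping the pairs of group elements by their product turns [E (E w)] into a convolution of the
    character with itself. *)
Lemma E_op_irr_char_idem (act : signed_perm n -> {linear ext -> ext}) i w :
  (forall g h x, act (g * h)%g x = act g (act h x)) -> a i != 0 ->
  let E := E_op phi (fun g => act g) (irr_char i) in E (E w) = E w *+ #|G|.
Proof.
move=> actM ai /=.
have := @Rpsi_img_convolution i _ ai; rewrite /E_op.
move: (irr_char i) => chi conv; rewrite scalerMnr; congr (_ *: _).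
transitivity (\sum_(k in G) (Rpsi_img phi (chi k) *+ #|G|) *: act k^-1%g w);
  last by rewrite -sumrMnl; apply: eq_bigr => g _; rewrite scalerMnl.
under [RHS]eq_bigr => k Gk do
  rewrite -conv // -scalerA scaler_suml.
under [LHS]eq_bigr => g Gg do
  rewrite linearZ linear_sum scalerA mulrC -scalerA scaler_sumr.
rewrite -!scaler_sumr; congr (_ *: _).
rewrite exchange_big [RHS]exchange_big /=; apply: eq_bigr => h Gh.
(* With [h] the convolution variable, the product is written [h * g], whose inverse acts as [h^-1]
   followed by [g^-1]. *)
rewrite [RHS](reindex_inj (mulgI h)) /=.
apply: eq_big => g; first by rewrite groupMl.
by move=> Gg; rewrite linearZ scalerA mulKg invMg actM mulrC.
Qed.

End ScalarOperators.

(** * Reordering pairwise commuting factors *)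

(** The head of [r1] is located in [r2] and moved to the front past the factors [s1] that precede
    it. *)
Lemma perm_big_comm (A : pzSemiRingType) (I : eqType) (r1 r2 : seq I)
    (F : I -> A) : (forall i j, GRing.comm (F i) (F j)) -> perm_eq r1 r2 ->
  \prod_(i <- r1) F i = \prod_(i <- r2) F i.
Proof.
move=> commF; elim: r1 r2 => [|i r1 IHr] r2; first by rewrite perm_sym => /perm_nilP->.
move=> perm_r; have ir2 : i \in r2 by rewrite -(perm_mem perm_r) mem_head.
case/splitPr: ir2 perm_r => s1 s2.
rewrite perm_sym perm_catC /= perm_cons perm_catC perm_sym => /IHr {IHr}IHr.
rewrite big_cons IHr !big_cat big_cons /= !mulrA; congr (_ * _).
by apply: commr_prod => j _.
Qed.

Lemma reindex_perm_comm (A : pzSemiRingType) (I : finType) (s : {perm I})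
    (F : I -> A) : (forall i j, GRing.comm (F i) (F j)) ->
  \prod_i F (s i) = \prod_i F i.
Proof.
move=> commF; rewrite -(big_map s predT F); apply: perm_big_comm => //.
apply: uniq_perm; rewrite ?(map_inj_uniq (@perm_inj _ s)) ?index_enum_uniq //.
move=> i; rewrite mem_index_enum; apply/mapP; exists ((s^-1)%g i) => //.
by rewrite permKV.
Qed.

(** * Power series with coefficients in the exterior algebra *)

Section Exterior.
Variables (R : comPzRingType) (m : nat).
Local Notation ext := (extalg R m).
Implicit Types (x y z : ext) (p q : fps ext).

Lemma comm_ext_scale (c d : R) x y :
  GRing.comm x y -> GRing.comm (c *: x) (d *: y).
Proof.
by rewrite /GRing.comm => xy; rewrite -!ext_scaleAl -!ext_scaleAr !scalerA xy mulrC.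
Qed.

(** Moving a generator across a product of two generators changes the sign twice. *)
Lemma comm_ext_gen2 i j k l :
  GRing.comm (ext_gen R i * ext_gen R j) (ext_gen R k * ext_gen R l : ext).
Proof.
have H a b c : GRing.comm (ext_gen R a * ext_gen R b) (ext_gen R c : ext).
  rewrite /GRing.comm -mulrA (ext_gen_anticomm R b c) mulrN [X in - X]mulrA.
  by rewrite (ext_gen_anticomm R a c) mulNr opprK mulrA.
by apply: commrM.
Qed.

Lemma ext_lift_comp (L : {linear ext -> ext}) (h : 'I_m -> ext) x :
  L 1 = 1 -> {morph L : y z / y * z} ->
  L (ext_lift h x) = ext_lift (fun i => L (h i)) x.
Proof.
move=> L1 LM; rewrite /ext_lift linear_sum; apply: eq_bigr => S _.
by rewrite linearZ (big_morph L LM L1).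
Qed.

Lemma eq_ext_lift (h h' : 'I_m -> ext) : h =1 h' -> ext_lift h =1 ext_lift h'.
Proof.
by move=> hh' x; apply: eq_bigr => S _; congr (_ *: _); apply: eq_bigr.
Qed.

Lemma fps_scaleAl (c : R) p q : c *: (p * q) = (c *: p) * q.
Proof.
apply/funext=> M; rewrite /GRing.scale /= /GRing.mul /= /fps_mul scaler_sumr.
by apply: eq_bigr => k _; rewrite ext_scaleAl.
Qed.

Lemma fps_scaleAr (c : R) p q : c *: (p * q) = p * (c *: q).
Proof.
apply/funext=> M; rewrite /GRing.scale /= /GRing.mul /= /fps_mul scaler_sumr.
by apply: eq_bigr => k _; rewrite ext_scaleAr.
Qed.

Lemma fps_sumE (I : Type) (r : seq I) (P : pred I) (p : I -> fps ext) M :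
  (\sum_(i <- r | P i) p i) M = \sum_(i <- r | P i) p i M.
Proof. exact: (big_morph (fun q : fps ext => q M)). Qed.

Lemma fps_mulnE p k M : (p *+ k) M = p M *+ k.
Proof. by elim: k => [|k IHk] //; rewrite !mulrS -IHk. Qed.

Lemma fps_map_mul (L : {additive ext -> ext}) :
  {morph L : x y / x * y} -> {morph fps_map L : p q / p * q}.
Proof.
move=> LM p q; apply/funext=> M; rewrite /fps_map [LHS]raddf_sum.
by apply: eq_bigr => k _; rewrite LM.
Qed.

Lemma fps_map_one (L : {additive ext -> ext}) : L 1 = 1 -> fps_map L 1 = 1.
Proof.
by move=> L1; apply/funext=> -[|M]; [exact: L1 | exact: raddf0].
Qed.

Lemma fps_mapZ (L : {linear ext -> ext}) (c : R) p :
  fps_map L (c *: p) = c *: fps_map L p.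
Proof. by apply/funext=> M; exact: (linearZZ L). Qed.

Lemma fps_map_at (L : {linear ext -> ext}) (f : fps R) x :
  L 1 = 1 -> {morph L : y z / y * z} ->
  fps_map L (fps_at f x) = fps_at f (L x).
Proof.
move=> L1 LM; apply/funext=> M; rewrite /fps_map /fps_at linearZ; congr (_ *: _).
by elim: M => [|M IHM]; rewrite ?expr0 // !exprS LM IHM.
Qed.

Lemma comm_fps_at (f : fps R) x y :
  GRing.comm x y -> GRing.comm (fps_at f x) (fps_at f y).
Proof.
move=> xy; apply/funext=> M; rewrite [RHS]fps_mul_rev; apply: eq_bigr => k _.
by apply: comm_ext_scale; apply: commrX; apply/commr_sym/commrX.
Qed.

Lemma fps_varM p : fps_var ext * p = fun M => if M is M'.+1 then p M' else 0.
Proof.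
apply/funext=> -[|M]; rewrite /GRing.mul /= /fps_mul /fps_var.
  by rewrite big_ord1 mul0r.
rewrite 2!big_ord_recl big1 => [|k _]; last by rewrite mul0r.
by rewrite mul0r add0r mul1r addr0 subSS subn0.
Qed.

Lemma fps_monomialE (c : R) k x :
  (c *: fps_var ext) ^+ k * fps_const x =
  fun M => if M == k then c ^+ k *: x else 0.
Proof.
elim: k => [|k IHk].
  by rewrite expr0 mul1r; apply/funext=> M; rewrite expr0 scale1r.
rewrite exprS -mulrA IHk -fps_scaleAl fps_varM; apply/funext=> -[|M].
  exact: scaler0.
transitivity (c *: (if M == k then c ^+ k *: x else 0)) => //.
by rewrite eqSS; case: (M == k); rewrite ?scaler0 // exprS scalerA.
Qed.

(** Meant for [Eu] and [Ev_bar], which are linear maps: the monomial sits in a single degree, where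
    [L] meets a scalar multiple of [x]. *)
Lemma fps_map_monomial (L : {linear ext -> ext}) (c : R) k x :
  fps_map L ((c *: fps_var ext) ^+ k * fps_const x) =
  (c *: fps_var ext) ^+ k * fps_const (L x).
Proof.
apply/funext=> M; rewrite !fps_monomialE /fps_map.
by case: ifP => _; rewrite ?linearZ ?linear0.
Qed.

(** Nilpotency truncates [f] after degree 1. The term in t comes first so that [bigA_distr] assigns
    it to the indices in [J]. *)
Lemma fps_at_sqr0 (f : fps R) x : x * x = 0 ->
  fps_at f x =
  (f 1%N *: fps_var ext) * fps_const x + f 0%N *: (1 : fps ext).
Proof.
move=> xx; rewrite -[_ *: fps_var ext]expr1 fps_monomialE; apply/funext=> M.
transitivity ((if M == 1%N then f 1%N ^+ 1 *: x else 0) +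
              f 0%N *: (if M == 0%N then (1 : ext) else 0)) => //.
rewrite /fps_at; case: M => [|[|M]].
- by rewrite add0r.
- by rewrite scaler0 addr0 !expr1.
- by rewrite !exprS mulrA xx mul0r !scaler0 addr0.
Qed.

(** Centrality of [T] lets its powers gather in front while the [x i] keep their order. *)
Lemma prod_if_monomial (I : finType) (J : {set I}) (c : R) (T : fps ext)
    (x : I -> ext) : (forall p, GRing.comm T p) ->
  \prod_i (if i \in J then T * fps_const (x i) else c *: (1 : fps ext)) =
  c ^+ (#|I| - #|J|) *: (T ^+ #|J| * fps_const (\prod_(i in J) x i)).
Proof.
(* Counting the exponent on the complement of [J] turns both cardinals into sums over
   [index_enum I], ready for list induction. *)
move=> commT; have -> : (#|I| - #|J|)%N = #|~: J| by rewrite [RHS]cardsCs setCK.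
rewrite -!sum1_card.
elim: (index_enum I) => [|i r IHr].
  rewrite !big_nil scale1r mul1r.
  by apply/funext=> -[|M].
have constM y z : fps_const (y * z) = fps_const y * fps_const z.
  apply/funext=> M; rewrite [RHS]big_ord_recl big1 => [|k _].
    by rewrite addr0 subn0 /fps_const; case: ifP => // _; rewrite mulr0.
  by rewrite mul0r.
rewrite !big_cons IHr inE; case: (i \in J) => /=.
  rewrite exprS constM -fps_scaleAr; congr (_ *: _).
  rewrite -!mulrA; congr (_ * _); rewrite !mulrA; congr (_ * _).
  by apply: commrX; apply/commr_sym/commT.
by rewrite exprS -fps_scaleAl mul1r scalerA.
Qed.

Lemma prod_fps_at (I : finType) (f : fps R) (x : I -> ext) :
  (forall i, x i * x i = 0) ->
  \prod_i fps_at f (x i) =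
  \sum_(J : {set I}) f 0%N ^+ (#|I| - #|J|) *:
    ((f 1%N *: fps_var ext) ^+ #|J| * fps_const (\prod_(i in J) x i)).
Proof.
move=> xx; under eq_bigr => i _ do rewrite fps_at_sqr0 //.
rewrite bigA_distr; apply: eq_bigr => J _; apply: prod_if_monomial => p.
(* It remains that t is central: multiplying by it on either side is the same shift of
   coefficients. *)
rewrite /GRing.comm -fps_scaleAl -fps_scaleAr; congr (_ *: _).
rewrite fps_varM; apply/funext=> M; rewrite [RHS]fps_mul_rev.
case: M => [|M]; first by rewrite big_ord1 mulr0.
rewrite 2!big_ord_recl big1 => [|k _]; last by rewrite mulr0.
by rewrite mulr0 add0r mulr1 addr0 subSS subn0.
Qed.

End Exterior.

(** * Signed permutations acting on the variables u and v *)

Section SignedPermutationActions.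
Variables (R : comPzRingType) (n : nat).
Local Notation ext := (extalg R (n + n)).
Implicit Types (g h : signed_perm n) (J : {set 'I_n}) (x : ext).
Local Notation u := (@ugen R n).
Local Notation v := (@vgen R n).

Lemma uact1 g : uact g (1 : ext) = 1. Proof. exact: ext_lift1. Qed.
Lemma vact1 g : vact g (1 : ext) = 1. Proof. exact: ext_lift1. Qed.

(** By [ext_lift_comp] it suffices to compare generators, where the two signs multiply according to
    the group law. *)
Lemma uact_comp g h x : uact (g * h)%g x = uact g (uact h x).
Proof.
rewrite {3}/uact (@ext_lift_comp _ _ (uact g) _ _ (uact1 g) (@uactM _ _ g)).
apply: eq_ext_lift => k; case: split => i /=; last by rewrite uact_vgen.
by rewrite linearZ /= uact_ugen scalerA ffunE permM permK signr_addb mulrC.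
Qed.

Lemma vact_uprod g J : vact g (uprod R J) = uprod R J.
Proof.
rewrite /uprod (big_morph (vact g) (@vactM _ _ g) (vact1 g)).
by apply: eq_bigr => j _; rewrite vact_ugen.
Qed.

Lemma uact_vact_vprod g h J :
  uact g (vact h (vprod R J)) = vact h (vprod R J).
Proof.
rewrite /vprod (big_morph (vact h) (@vactM _ _ h) (vact1 h)).
rewrite (big_morph (uact g) (@uactM _ _ g) (uact1 g)).
by apply: eq_bigr => j _; rewrite vact_vgen linearZ /= uact_vgen.
Qed.

(** The exponent stays a sum of ones over the list, the form met in the list induction of
    [prod_ugen_vgen]. *)
Lemma vgen_prod_ugen (I : Type) (r : seq I) (P : pred I) (s : I -> 'I_n) i :
  v i * \prod_(j <- r | P j) u (s j) =
  (-1) ^+ (\sum_(j <- r | P j) 1) *: (\prod_(j <- r | P j) u (s j) * v i).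
Proof.
elim: r => [|j r IHr]; first by rewrite !big_nil mulr1 mul1r scale1r.
rewrite !big_cons; case: (P j) => //.
have vu k : v i * u k = - (u k * v i) by exact: ext_gen_anticomm.
rewrite mulrA vu mulNr -(mulrA (u _) (v i)) IHr.
by rewrite -ext_scaleAr mulrA exprS mulN1r scaleNr.
Qed.

(** Adding an index to a set of size k makes one [v] cross k of the [u], and C(k+1,2) = C(k,2) +
    k. *)
Lemma prod_ugen_vgen J : \prod_(j in J) (u j * v j) =
  (-1) ^+ 'C(#|J|, 2) *: (uprod R J * vprod R J).
Proof.
rewrite /uprod /vprod -sum1_card.
elim: (index_enum _) => [|i r IHr]; first by rewrite !big_nil scale1r mulr1.
rewrite !big_cons; case: (i \in J) => //.
rewrite IHr -!ext_scaleAr -mulrA (mulrA (v i)) vgen_prod_ugen -ext_scaleAl.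
by rewrite -ext_scaleAr scalerA add1n binS bin1 exprD -!mulrA.
Qed.

(** Both sides are products of the same factors [H j], listed on the u-side in the order permuted by
    [g^-1]; these factors are even, so they commute. *)
Lemma uact_prod_fps_at g (f : fps R) M :
  uact g^-1%g ((\prod_(j < n) fps_at f (u j * v j)) M) =
  vact g ((\prod_(j < n) fps_at f (u j * v j)) M).
Proof.
rewrite -[LHS]/(fps_map (uact g^-1%g) _ M) -[RHS]/(fps_map (vact g) _ M).
rewrite (big_morph _ (fps_map_mul (@uactM _ _ _)) (fps_map_one (uact1 _))).
rewrite (big_morph _ (fps_map_mul (@vactM _ _ _)) (fps_map_one (vact1 _))).
congr (_ M).
pose H (j : 'I_n) := fps_at f ((-1) ^+ g.1 (g.2 j) *: (u j * v (g.2 j)) : ext).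
have HC i j : GRing.comm (H i) (H j).
  exact/comm_fps_at/comm_ext_scale/comm_ext_gen2.
transitivity (\prod_j H ((g.2^-1)%g j)); last rewrite reindex_perm_comm //.
  apply: eq_bigr => j _; rewrite (fps_map_at _ _ (uact1 _) (@uactM _ _ _)) /=.
  by rewrite uactM uact_ugen uact_vgen /= ffunE -ext_scaleAl /H permKV.
apply: eq_bigr => j _; rewrite (fps_map_at _ _ (vact1 _) (@vactM _ _ _)) /=.
by rewrite vactM vact_ugen vact_vgen -ext_scaleAr.
Qed.

End SignedPermutationActions.

(** * The isotypic operators on the u- and v-variables *)

Section IsotypicOperators.
Variables (K : realType) (n : nat) (G : {group signed_perm n}).
Variable a : irr_index K G -> complex K.
Variables (R : comPzRingType) (phi : {rmorphism Rpsi a -> R}).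
Local Notation ext := (extalg R (n + n)).
Implicit Type i : irr_index K G.

Lemma Eu_linear i : linear (Eu phi i).
Proof. exact: (E_op_linear phi (fun g => uact g : {linear ext -> ext})). Qed.

Lemma Ev_bar_linear i : linear (Ev_bar phi i).
Proof. exact: (E_op_linear phi (fun g => vact g : {linear ext -> ext})). Qed.

HB.instance Definition _ i :=
  GRing.isLinear.Build R ext ext _ (Eu phi i) (Eu_linear i).
HB.instance Definition _ i :=
  GRing.isLinear.Build R ext ext _ (Ev_bar phi i) (Ev_bar_linear i).

Lemma Eu_idem i w : a i != 0 -> Eu phi i (Eu phi i w) = Eu phi i w *+ #|G|.
Proof.
apply: (E_op_irr_char_idem phi (act := fun g => uact g : {linear ext -> ext})).
exact: uact_comp.
Qed.

(** Since the conjugate of chi at g is chi at [g^-1], replacing [g] by its inverse in the sum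
    matches the two operators. *)
Lemma Eu_eq_Ev_bar i (w : ext) :
  (forall g, uact g^-1%g w = vact g w) -> Eu phi i w = Ev_bar phi i w.
Proof.
move=> uvw; rewrite /Eu /Ev_bar /E_op conj_irr_char // invg1.
congr (_ *: _); rewrite (reindex_inj invg_inj) /=.
apply: eq_big => g; rewrite groupV // => Gg.
by rewrite uvw conj_irr_char.
Qed.

(** Each group acts by algebra maps fixing the other family of variables, so each operator passes
    the other factor without a sign. *)
Lemma Eu_Ev_bar_mul i J :
  Eu phi i (Ev_bar phi i (uprod R J * vprod R J)) =
  Eu phi i (uprod R J) * Ev_bar phi i (vprod R J).
Proof.
have -> : Ev_bar phi i (uprod R J * vprod R J) =
    uprod R J * Ev_bar phi i (vprod R J).
  apply: (@E_op_mull _ _ _ _ _ _ (fun g => vact g : {linear ext -> ext})).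
  by move=> g x /=; rewrite vactM vact_uprod.
apply: (@E_op_mulr _ _ _ _ _ _ (fun g => uact g : {linear ext -> ext})).
move=> g x /=; rewrite uactM; congr (_ * _).
rewrite linearZ linear_sum; congr (_ *: _); apply: eq_bigr => h _.
by rewrite linearZ /= uact_vact_vprod.
Qed.

End IsotypicOperators.

Theorem theorem3p1 (K : realType) (n : nat) (n_ge1 : (1 <= n)%N)
    (G : {group signed_perm n})
    (psi : signed_perm n -> complex K) (a : irr_index K G -> complex K)
    (psi_class : is_class_fun G psi) (psiE : irr_expansion psi a)
    (R : comPzRingType) (phi : {rmorphism Rpsi a -> R}) (f : fps R) :
  let F : fps (extalg R (n + n)) :=
    \prod_(j < n) fps_at f (ugen R j * vgen R j) in
  fps_map (Eu_psi phi) F *+ #|G| = fps_map (Ev_psibar phi) F *+ #|G| /\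
  fps_map (Ev_psibar phi) F *+ #|G| =
    \sum_(i : irr_index K G | a i != 0) Rpsi_img phi (a i) *:
      \sum_(J : {set 'I_n})
        ((-1) ^+ 'C(#|J|, 2) * f 0%N ^+ (n - #|J|)) *:
          ((f 1%N *: fps_var (extalg R (n + n))) ^+ #|J| *
           fps_const (Eu phi i (uprod R J) * Ev_bar phi i (vprod R J))).
Proof.
move=> F.
have EuF i M : Eu phi i (F M) = Ev_bar phi i (F M).
  by apply: Eu_eq_Ev_bar => g; apply: uact_prod_fps_at.
have uv_sqr (j : 'I_n) : (ugen R j * vgen R j) * (ugen R j * vgen R j) = 0.
  rewrite mulrA -(mulrA (ugen R j)) /ugen /vgen ext_gen_anticomm.
  by rewrite mulrN mulrA ext_gen_sqr mul0r oppr0 mul0r.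
have FE : F = \sum_(J : {set 'I_n})
    ((-1) ^+ 'C(#|J|, 2) * f 0%N ^+ (n - #|J|)) *:
      ((f 1%N *: fps_var (extalg R (n + n))) ^+ #|J| *
       fps_const (uprod R J * vprod R J)).
  rewrite /F prod_fps_at // card_ord; apply: eq_bigr => J _.
  rewrite prod_ugen_vgen mulrC -scalerA; congr (_ *: _).
  (* Comparing coefficients of t moves the reordering sign out of the constant. *)
  rewrite !fps_monomialE; apply/funext=> M.
  transitivity ((-1) ^+ 'C(#|J|, 2) *:
    (if M == #|J| then f 1%N ^+ #|J| *: (uprod R J * vprod R J) else 0)) => //.
  by case: ifP => _; rewrite ?scaler0 // !scalerA mulrC.
split.
  congr (_ *+ _); apply/funext=> M; rewrite /fps_map /Eu_psi /Ev_psibar.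
  by apply: eq_bigr => i _; rewrite EuF.
apply/funext=> M; rewrite fps_mulnE fps_sumE /fps_map /Ev_psibar -sumrMnl.
(* The chain is |G| E^v F = |G| E^u F = E^u (E^u F) = E^u (E^v F); the last [EuF] rewrites the inner
   operator. *)
apply: eq_bigr => i ai; rewrite scalerMnr -EuF -Eu_idem // EuF.
rewrite FE; transitivity (Rpsi_img phi (a i) *: (\sum_(J : {set 'I_n})
        ((-1) ^+ 'C(#|J|, 2) * f 0%N ^+ (n - #|J|)) *:
          ((f 1%N *: fps_var (extalg R (n + n))) ^+ #|J| *
           fps_const (Eu phi i (uprod R J) * Ev_bar phi i (vprod R J)))) M) => //.
congr (_ *: _); rewrite !fps_sumE !linear_sum; apply: eq_bigr => J _.
(* On each summand of the target, the operators are pulled back out of the constant, the power of t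
   and the scalar. *)
rewrite -Eu_Ev_bar_mul -!fps_map_monomial.
by rewrite -!fps_mapZ.
Qed.
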